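(* Let $X$ be a non-empty set, let $\mathsf{FFBR}(X)$ be the free $X$-generated $F$-birestriction monoid, and let $\mathcal I$ be the inverse monoid $$\mathcal I=\mathrm{Inv}\langle X\cup\overline{X^+}\mid \overline{x}\ge x\ (x\in X),\ \ \overline{uv}\ge\overline{u}\,\overline{v}\ (u,v\in X^+)\rangle .$$ Then the map $x\mapsto (x^+,x)$, $x\in X$, extends to an $X$-canonical $(2,1,1,1,0)$-isomorphism $$\mathsf{FFBR}(X)\simeq E(\mathcal I)\rtimes X^* .$$ In detail, $$E(\mathcal I)\rtimes X^*=\{(e,u)\in E(\mathcal I)\times X^*: e\le \overline{u}^{\,+}\}$$ with identity element $(1,1)$ and the remaining operations given by $$(e,u)(f,v)=(e(\overline{u}f)^+,uv),\qquad (e,u)^*=((e\overline{u})^*,1),\qquad (e,u)^+=(e,1),\qquad (e,u)^{\mathfrak m}=(\overline{u}^{\,+},u).$$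
   Context: A birestriction monoid is an algebra $(S;\cdot,{}^*,{}^+,1)$ such that $(S;\cdot,1)$ is a monoid and for all $x,y$: $xx^*=x$, $x^*y^*=y^*x^*$, $(xy^* )^*=x^*y^*$, $x^*y=y(xy)^*$; $x^+x=x$, $x^+y^+=y^+x^+$, $(x^+y)^+=x^+y^+$, $xy^+=(xy)^+x$; $(x^+)^*=x^+$, $(x^* )^+=x^*$. Its projections are $P(S)=\{s^*:s\in S\}=\{s^+:s\in S\}$. The natural partial order is: $s\le t$ iff $s=et$ for some $e\in P(S)$ (equivalently, $s=ts^*$; equivalently, $s=s^+t$). The relation $\sigma$ is the minimum congruence identifying all projections: $s\mathrel{\sigma}t$ iff $se=te$ for some $e\in P(S)$. An $F$-birestriction monoid is a birestriction monoid in which every $\sigma$-class has a maximum element; $s^{\mathfrak m}$ denotes the maximum element of the $\sigma$-class of $s$. $F$-birestriction monoids are regarded as algebras $(S;\cdot,{}^*,{}^+,{}^{\mathfrak m},1)$ of type $(2,1,1,1,0)$ (they form a variety), and $\mathsf{FFBR}(X)$ is the free algebra on $X$ in this variety. An isomorphism is $X$-canonical if it commutes with the assignment maps from $X$. $X^+$, $X^*$ are the free semigroup and free monoid on $X$; $\overline{X^+}=\{\overline{u}:u\in X^+\}$ is a set disjoint from $X$ in bijection with $X^+$. In an inverse monoid, $a^*=a^{-1}a$, $a^+=aa^{-1}$, $E(\cdot)$ is the semilattice of idempotents, and a relation $a\ge b$ abbreviates $b=ab^*$. $\mathrm{Inv}\langle Y\mid R\rangle$ denotes an inverse monoid presentation.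 The symbols $x$, $\overline{u}$ denote also their values in $\mathcal I$, and $\overline{1}=1$ for the empty word $1\in X^*$. *)

(* Defs.v *)
From HB Require Import structures.
From mathcomp Require Import all_boot boolp.

Set Implicit Arguments.
Unset Strict Implicit.
Unset Printing Implicit Defensive.

Local Open Scope group_scope.
Local Open Scope quotient_scope.

HB.mixin Record hasStarPlus S := { star : S -> S; plus : S -> S }.

(* the bare signature (2,1,1,0), without axioms *)
#[short(type="birestrictionOpsType")]
HB.structure Definition BirestrictionOps :=
  {S of hasStarPlus S & BaseUMagma S}.

HB.mixin Record Monoid_isBirestriction S of BirestrictionOps S & Monoid S := {
  mul_star : forall x : S, x * star x = x;
  star_comm : forall x y : S, star x * star y = star y * star x;
  star_mul_star : forall x y : S, star (x * star y) = star x * star y;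
  star_mul : forall x y : S, star x * y = y * star (x * y);
  plus_mul : forall x : S, plus x * x = x;
  plus_comm : forall x y : S, plus x * plus y = plus y * plus x;
  plus_plus_mul : forall x y : S, plus (plus x * y) = plus x * plus y;
  mul_plus : forall x y : S, x * plus y = plus (x * y) * x;
  star_plus : forall x : S, star (plus x) = plus x;
  plus_star : forall x : S, plus (star x) = star x }.

#[short(type="birestrictionType")]
HB.structure Definition Birestriction :=
  {S of Monoid_isBirestriction S & BirestrictionOps S & Monoid S}.

Section BirestrictionDefs.
Variable S : birestrictionOpsType.
Implicit Types (s t e f : S) (r : S -> S -> Prop).

Definition projection e := exists s, e = star s.

Definition natle s t := exists2 e, projection e & s = e * t.

Record congruence r : Prop := Congruence {
  cong_refl : forall s, r s s;
  cong_sym : forall s t, r s t -> r t s;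
  cong_trans : forall t s u, r s t -> r t u -> r s u;
  cong_mul : forall s s' t t', r s s' -> r t t' -> r (s * t) (s' * t');
  cong_star : forall s t, r s t -> r (star s) (star t);
  cong_plus : forall s t, r s t -> r (plus s) (plus t) }.

(* the minimum congruence identifying all projections; see [sigmaP] *)
Definition sigma s t :=
  forall r, congruence r ->
    (forall e f, projection e -> projection f -> r e f) -> r s t.

End BirestrictionDefs.

HB.mixin Record hasSigmaMax S := { sigmax : S -> S }.

(* the bare signature (2,1,1,1,0), without axioms *)
#[short(type="fbirestrictionOpsType")]
HB.structure Definition FBirestrictionOps :=
  {S of hasSigmaMax S & BirestrictionOps S}.

HB.mixin Record Birestriction_isF S
    of FBirestrictionOps S & Birestriction S := {
  sigmax_sigma : forall s : S, sigma s (sigmax s);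
  sigmax_max : forall s t : S, sigma s t -> natle t (sigmax s) }.

#[short(type="fbirestrictionType")]
HB.structure Definition FBirestriction :=
  {S of Birestriction_isF S & FBirestrictionOps S & Birestriction S}.

Record fbr_hom (S T : fbirestrictionOpsType) (g : S -> T) : Prop := FbrHom {
  fbr_hom_mul : {morph g : s t / s * t};
  fbr_hom_one : g 1 = 1;
  fbr_hom_star : {morph g : s / star s};
  fbr_hom_plus : {morph g : s / plus s};
  fbr_hom_sigmax : {morph g : s / sigmax s} }.

Section BirestrictionTheory.
Variable S : birestrictionType.
Implicit Types s t e f : S.

Lemma projection_plus e : projection e <-> exists s, e = plus s.
Proof.
by split=> -[s ->]; [exists (star s); rewrite plus_star
                    |exists (plus s); rewrite star_plus].
Qed.

Lemma projectionM e f : projection e -> projection f -> projection (e * f).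
Proof. by move=> [s ->] [t ->]; exists (s * star t); rewrite star_mul_star. Qed.

Lemma projection_star e : projection e -> star e = e.
Proof. by move=> [s ->]; rewrite -(plus_star s) star_plus. Qed.

Lemma sigmaP s t : sigma s t <-> exists2 e, projection e & s * e = t * e.
Proof.
split; last first.
  move=> [e [w ->] E] r rC rP.
  have r1 : r (star w) 1.
    apply: rP; first by exists w.
    by exists 1; rewrite -[LHS](mul_star (1 : S)) mul1g.
  have rs (q : S) : r q (q * star w).
    apply: (cong_sym rC); rewrite -[X in r _ X]mulg1.
    by apply: (cong_mul rC) => //; apply: (cong_refl rC).
  apply: (cong_trans rC) (rs s) _; rewrite E.
  exact: (cong_sym rC).
have PP (u v : S) : projection u -> projection v ->
    exists2 e, projection e & u * e = v * e.
  move=> [a ->] [b ->]; exists (star a * star b).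
    by apply: projectionM; [exists a|exists b].
  have idem (q : S) : star q * star q = star q.
    by rewrite -star_mul_star mul_star.
  by rewrite mulgA idem (star_comm a) mulgA idem.
move=> /(_ (fun u v => exists2 e, projection e & u * e = v * e)).
apply; last exact: PP.
have P1 : projection (1 : S) by exists 1; rewrite -[LHS](mul_star (1 : S)) mul1g.
split=> //.
- by move=> u; exists 1.
- by move=> u v [e Pe E]; exists e.
- move=> v u w [e Pe E] [f Pf F]; exists (e * f); first exact: projectionM.
  have C : e * f = f * e.
    by move: Pe Pf => [a ->] [b ->]; rewrite star_comm.
  by rewrite mulgA E -mulgA C mulgA F mulgA.
- move=> u u' v v' [e [a ->] E] [f Pf F].
  exists (star (a * v) * f); first by apply: projectionM => //; exists (a * v).
  have C : star (a * v) * f = f * star (a * v).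
    by move: Pf => [b ->]; rewrite star_comm.
  have U : u * v * star (a * v) = u' * v * star (a * v).
    by rewrite -!mulgA -star_mul !mulgA E.
  by rewrite mulgA U -!mulgA C [v * _]mulgA F -!mulgA.
- by move=> u v _; apply: PP; [exists u|exists v].
- by move=> u v _; apply: PP; apply/projection_plus; [exists u|exists v].
Qed.

Lemma natle_starP s t : natle s t <-> s = t * star s.
Proof.
split=> [[e Pe ->]|E].
  by rewrite -{1}(projection_star Pe) star_mul.
exists (plus s); first by apply/projection_plus; exists s.
by rewrite {1}E -{1}(plus_star s) mul_plus -E.
Qed.

Lemma natle_plusP s t : natle s t <-> s = plus s * t.
Proof.
split=> [[e /projection_plus [a ->] ->]|E].
  by rewrite plus_plus_mul -mulgA plus_mul.
by exists (plus s) => //; apply/projection_plus; exists s.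
Qed.

End BirestrictionTheory.

Inductive fterm (X : Type) : Type :=
| FGen of X | FOne | FMul of fterm X & fterm X
| FStar of fterm X | FPlus of fterm X | FMax of fterm X.
Arguments FOne {X}.

HB.instance Definition _ X := gen_eqMixin (fterm X).
HB.instance Definition _ X := gen_choiceMixin (fterm X).

Fixpoint feval X (S : fbirestrictionOpsType) (f : X -> S) (t : fterm X) : S :=
  match t with
  | FGen x => f x
  | FOne => 1
  | FMul a b => feval f a * feval f b
  | FStar a => star (feval f a)
  | FPlus a => plus (feval f a)
  | FMax a => sigmax (feval f a)
  end.

(* The free algebra of the variety: terms modulo the identities that hold in
   every F-birestriction monoid; the universal property is [ffbr_universal]. *)
Section FFBR.
Variable X : Type.

Definition fidentity (a b : fterm X) : Prop :=
  forall (S : fbirestrictionType) (f : X -> S), feval f a = feval f b.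

Definition fidentityb (a b : fterm X) : bool := `[< fidentity a b >].

Lemma fidentityb_refl : reflexive fidentityb.
Proof. by move=> a; apply/asboolP. Qed.

Lemma fidentityb_sym : symmetric fidentityb.
Proof.
move=> a b; apply/idP/idP => /asboolP E; apply/asboolP => S f; exact/esym/E.
Qed.

Lemma fidentityb_trans : transitive fidentityb.
Proof.
by move=> b a c /asboolP E /asboolP F; apply/asboolP => S f; rewrite E F.
Qed.

Canonical fidentity_equiv :=
  EquivRel fidentityb fidentityb_refl fidentityb_sym fidentityb_trans.

Definition FFBR := {eq_quot fidentity_equiv}.
HB.instance Definition _ := Choice.on FFBR.

Definition fclass (t : fterm X) : FFBR := \pi_FFBR t.

Definition ffbr_gen (x : X) : FFBR := fclass (FGen x).

Lemma fclassP a b : fclass a = fclass b <-> fidentity a b.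
Proof.
split; last by move=> E; apply/eqmodP/asboolP.
by move/eqmodP => /= /asboolP.
Qed.

Definition ffbr_mul (p q : FFBR) : FFBR := fclass (FMul (repr p) (repr q)).
Definition ffbr_one : FFBR := fclass FOne.
Definition ffbr_star (p : FFBR) : FFBR := fclass (FStar (repr p)).
Definition ffbr_plus (p : FFBR) : FFBR := fclass (FPlus (repr p)).
Definition ffbr_max (p : FFBR) : FFBR := fclass (FMax (repr p)).

Lemma frepr a : fidentity (repr (fclass a)) a.
Proof. by apply/fclassP; rewrite /fclass reprK. Qed.

Lemma fclass_mul a b : fclass (FMul a b) = ffbr_mul (fclass a) (fclass b).
Proof. by apply/fclassP => S f /=; rewrite !(frepr _ f). Qed.

Lemma fclass_star a : fclass (FStar a) = ffbr_star (fclass a).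
Proof. by apply/fclassP => S f /=; rewrite !(frepr _ f). Qed.

Lemma fclass_plus a : fclass (FPlus a) = ffbr_plus (fclass a).
Proof. by apply/fclassP => S f /=; rewrite !(frepr _ f). Qed.

Lemma fclass_max a : fclass (FMax a) = ffbr_max (fclass a).
Proof. by apply/fclassP => S f /=; rewrite !(frepr _ f). Qed.

Lemma fclass_surj p : exists a, p = fclass a.
Proof. by exists (repr p); rewrite /fclass reprK. Qed.

Let fE := (=^~ fclass_mul, =^~ fclass_star, =^~ fclass_plus, =^~ fclass_max).

Fact ffbr_mulA : associative ffbr_mul.
Proof.
move=> p q r.
have [[a ->] [b ->] [c ->]] := And3 (fclass_surj p) (fclass_surj q) (fclass_surj r).
by rewrite !fE; apply/fclassP => S f /=; rewrite mulgA.
Qed.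

Fact ffbr_mul1 : left_id ffbr_one ffbr_mul.
Proof.
move=> p; have [a ->] := fclass_surj p.
by rewrite /ffbr_one !fE; apply/fclassP => S f /=; rewrite mul1g.
Qed.

Fact ffbr_1mul : right_id ffbr_one ffbr_mul.
Proof.
move=> p; have [a ->] := fclass_surj p.
by rewrite /ffbr_one !fE; apply/fclassP => S f /=; rewrite mulg1.
Qed.

HB.instance Definition _ := isMonoid.Build FFBR ffbr_mulA ffbr_mul1 ffbr_1mul.
HB.instance Definition _ := hasStarPlus.Build FFBR ffbr_star ffbr_plus.
HB.instance Definition _ := hasSigmaMax.Build FFBR ffbr_max.

Lemma fclassM a b : fclass (FMul a b) = fclass a * fclass b.
Proof. exact: fclass_mul. Qed.
Lemma fclass1 : fclass FOne = 1. Proof. by []. Qed.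
Lemma fclass_starE a : fclass (FStar a) = star (fclass a).
Proof. exact: fclass_star. Qed.
Lemma fclass_plusE a : fclass (FPlus a) = plus (fclass a).
Proof. exact: fclass_plus. Qed.
Lemma fclass_maxE a : fclass (FMax a) = sigmax (fclass a).
Proof. exact: fclass_max. Qed.

Let gE := (=^~ fclassM, =^~ fclass_starE, =^~ fclass_plusE, =^~ fclass_maxE).

Local Ltac ident1 p :=
  have [a ->] := fclass_surj p;
  rewrite !gE; apply/fclassP => S f /=; rewrite ?(frepr _ _).
Local Ltac ident2 p q :=
  have [a ->] := fclass_surj p; have [b ->] := fclass_surj q;
  rewrite !gE; apply/fclassP => S f /=; rewrite ?(frepr _ _).

Fact ffbr_a1 (x : FFBR) : x * star x = x.
Proof. ident1 x; exact: mul_star. Qed.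
Fact ffbr_a2 (x y : FFBR) : star x * star y = star y * star x.
Proof. ident2 x y; exact: star_comm. Qed.
Fact ffbr_a3 (x y : FFBR) : star (x * star y) = star x * star y.
Proof. ident2 x y; exact: star_mul_star. Qed.
Fact ffbr_a4 (x y : FFBR) : star x * y = y * star (x * y).
Proof. ident2 x y; exact: star_mul. Qed.
Fact ffbr_a5 (x : FFBR) : plus x * x = x.
Proof. ident1 x; exact: plus_mul. Qed.
Fact ffbr_a6 (x y : FFBR) : plus x * plus y = plus y * plus x.
Proof. ident2 x y; exact: plus_comm. Qed.
Fact ffbr_a7 (x y : FFBR) : plus (plus x * y) = plus x * plus y.
Proof. ident2 x y; exact: plus_plus_mul. Qed.
Fact ffbr_a8 (x y : FFBR) : x * plus y = plus (x * y) * x.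
Proof. ident2 x y; exact: mul_plus. Qed.
Fact ffbr_a9 (x : FFBR) : star (plus x) = plus x.
Proof. ident1 x; exact: star_plus. Qed.
Fact ffbr_a10 (x : FFBR) : plus (star x) = star x.
Proof. ident1 x; exact: plus_star. Qed.

HB.instance Definition _ := Monoid_isBirestriction.Build FFBR
  ffbr_a1 ffbr_a2 ffbr_a3 ffbr_a4 ffbr_a5 ffbr_a6 ffbr_a7 ffbr_a8 ffbr_a9
  ffbr_a10.

Fact ffbr_max_sigma (p : FFBR) : sigma p (sigmax p).
Proof.
have [a ->] := fclass_surj p; apply/sigmaP.
exists (star (fclass a)); first by exists (fclass a).
rewrite !gE; apply/fclassP => S f /=; rewrite mul_star.
apply/natle_starP/sigmax_max/sigmaP; exists 1 => //.
by exists 1; rewrite -[LHS](mul_star (1 : S)) mul1g.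
Qed.

Fact ffbr_max_max (p q : FFBR) : sigma p q -> natle q (sigmax p).
Proof.
have [[a ->] [b ->]] := conj (fclass_surj p) (fclass_surj q).
move=> /sigmaP [e [c ->]]; have [d ->] := fclass_surj c => E.
apply/natle_plusP; rewrite !gE; apply/fclassP => S f /=; rewrite ?(frepr _ f).
apply/natle_plusP/sigmax_max/sigmaP.
exists (star (feval f d)); first by exists (feval f d).
by move: E; rewrite !gE => /fclassP /(_ S f) /=; rewrite ?(frepr _ f).
Qed.

HB.instance Definition _ :=
  Birestriction_isF.Build FFBR ffbr_max_sigma ffbr_max_max.

Theorem ffbr_universal (S : fbirestrictionType) (f : X -> S) :
  exists g : FFBR -> S,
    [/\ fbr_hom g, forall x, g (ffbr_gen x) = f x
      & forall h : FFBR -> S,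
          fbr_hom h -> (forall x, h (ffbr_gen x) = f x) -> h =1 g].
Proof.
exists (fun p => feval f (repr p)).
have evE a : feval f (repr (fclass a)) = feval f a by exact: frepr.
split.
- split.
  + move=> p q; have [[a ->] [b ->]] := conj (fclass_surj p) (fclass_surj q).
    by rewrite -fclassM !evE.
  + by rewrite -fclass1 evE.
  + by move=> p; have [a ->] := fclass_surj p; rewrite -fclass_starE !evE.
  + by move=> p; have [a ->] := fclass_surj p; rewrite -fclass_plusE !evE.
  + by move=> p; have [a ->] := fclass_surj p; rewrite -fclass_maxE !evE.
- by move=> x; rewrite /ffbr_gen evE.
move=> h [hM h1 hS hP hX] hx p; have [a ->] := fclass_surj p; rewrite evE.
elim: a => [x||a IHa b IHb|a IHa|a IHa|a IHa] /=.
- exact: hx.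
- exact: h1.
- by rewrite fclassM hM IHa IHb.
- by rewrite fclass_starE hS IHa.
- by rewrite fclass_plusE hP IHa.
- by rewrite fclass_maxE hX IHa.
Qed.

End FFBR.

(* The usual equational axioms; [inverse_unique] shows that they make x^-1 the
   unique inverse of x. *)
HB.mixin Record StarMonoid_isInverse S of StarMonoid S := {
  mulgVg : forall x : S, x * x^-1 * x = x;
  mulgV_comm : forall x y : S, x * x^-1 * (y * y^-1) = y * y^-1 * (x * x^-1) }.

#[short(type="inverseMonoidType")]
HB.structure Definition InverseMonoid :=
  {S of StarMonoid_isInverse S & StarMonoid S}.

Section InverseMonoidDefs.
Variable M : inverseMonoidType.
Implicit Types a b e f : M.

Definition istar a := a^-1 * a.
Definition iplus a := a * a^-1.
Definition idempotent e := e * e = e.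
(* the natural order b <= a, that is a >= b *)
Definition ile b a := b = a * istar b.

Lemma inv_idempotent e : idempotent e -> e^-1 = e.
Proof.
move=> ee.
have eV : e^-1 = e^-1 * e * (e * e^-1).
  rewrite !mulgA -[_ * e * e]mulgA ee.
  by have := mulgVg (e^-1); rewrite invgK => ->.
have C := mulgV_comm (e^-1) e; rewrite invgK in C.
have vv : e^-1 * e^-1 = e^-1 by rewrite -invgM ee.
by rewrite eV C mulgA -[_ * e^-1 * e^-1]mulgA vv mulgVg.
Qed.

Lemma idempotent_plusE e : idempotent e -> iplus e = e.
Proof. by move=> ee; rewrite /iplus inv_idempotent. Qed.

Lemma idempotent_starE e : idempotent e -> istar e = e.
Proof. by move=> ee; rewrite /istar inv_idempotent. Qed.

Lemma idempotent_comm e f : idempotent e -> idempotent f -> e * f = f * e.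
Proof.
move=> ee ff; rewrite -(idempotent_plusE ee) -(idempotent_plusE ff).
exact: mulgV_comm.
Qed.

Lemma idempotentM e f : idempotent e -> idempotent f -> idempotent (e * f).
Proof.
move=> ee ff; rewrite /idempotent mulgA -[e * f * e]mulgA.
by rewrite (idempotent_comm ff ee) mulgA ee -mulgA ff.
Qed.

Lemma idempotent_iplus a : idempotent (iplus a).
Proof. by rewrite /idempotent /iplus mulgA mulgVg. Qed.

Lemma idempotent_istar a : idempotent (istar a).
Proof. by have := idempotent_iplus (a^-1); rewrite /iplus invgK. Qed.

Lemma idempotent1 : idempotent 1.
Proof. exact: mulg1. Qed.

Lemma ile_idempotent e f : idempotent e -> ile e f <-> e = f * e.
Proof. by move=> ee; rewrite /ile idempotent_starE. Qed.

Lemma ile1 e : idempotent e -> ile e 1.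
Proof. by move=> ee; apply/ile_idempotent; rewrite ?mul1g. Qed.

Lemma ile_iplusK a b : ile b a -> iplus a * b = b.
Proof. by move=> ->; rewrite /iplus mulgA mulgVg. Qed.

Lemma ile_iplus a b : ile b a -> ile (iplus b) (iplus a).
Proof.
move=> ba; apply/ile_idempotent; first exact: idempotent_iplus.
by rewrite {3}/iplus mulgA ile_iplusK.
Qed.

Lemma inverse_unique a b : a * b * a = a -> b * a * b = b -> b = a^-1.
Proof.
move=> aba bab.
have iab : idempotent (a * b) by rewrite /idempotent mulgA aba.
have iba : idempotent (b * a) by rewrite /idempotent mulgA bab.
have vav : a^-1 * a * a^-1 = a^-1 by have := mulgVg (a^-1); rewrite invgK.
have bE : b = b * iplus a.
  transitivity (b * (iplus a * (a * b))).
    by rewrite /iplus [X in _ * X]mulgA mulgVg mulgA bab.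
  rewrite (idempotent_comm (idempotent_iplus a) iab) mulgA.
  by rewrite [b * (a * b)]mulgA bab.
rewrite bE; transitivity (b * a * istar a * a^-1).
  by rewrite /istar /iplus -!mulgA (mulgA a^-1) vav.
rewrite (idempotent_comm iba (idempotent_istar a)) /istar.
by rewrite -[_ * a * (b * a)]mulgA [a * (b * a)]mulgA aba vav.
Qed.

End InverseMonoidDefs.

Inductive iterm (Y : Type) : Type :=
| IGen of Y | IOne | IMul of iterm Y & iterm Y | IInv of iterm Y.
Arguments IOne {Y}.

HB.instance Definition _ Y := gen_eqMixin (iterm Y).
HB.instance Definition _ Y := gen_choiceMixin (iterm Y).

(* the congruence generated by R and the axioms of inverse monoids *)
Inductive icong Y (R : iterm Y -> iterm Y -> Prop) : iterm Y -> iterm Y -> Prop :=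
| icong_rel a b : R a b -> icong R a b
| icong_refl a : icong R a a
| icong_sym a b : icong R a b -> icong R b a
| icong_trans b a c : icong R a b -> icong R b c -> icong R a c
| icong_mul a a' b b' :
    icong R a a' -> icong R b b' -> icong R (IMul a b) (IMul a' b')
| icong_inv a b : icong R a b -> icong R (IInv a) (IInv b)
| icong_mulA a b c : icong R (IMul a (IMul b c)) (IMul (IMul a b) c)
| icong_mul1 a : icong R (IMul IOne a) a
| icong_1mul a : icong R (IMul a IOne) a
| icong_invK a : icong R (IInv (IInv a)) a
| icong_invM a b : icong R (IInv (IMul a b)) (IMul (IInv b) (IInv a))
| icong_mulVg a : icong R (IMul (IMul a (IInv a)) a) a
| icong_comm a b :
    icong R (IMul (IMul a (IInv a)) (IMul b (IInv b)))
            (IMul (IMul b (IInv b)) (IMul a (IInv a))).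

Section Presentation.
Variables (Y : Type) (R : iterm Y -> iterm Y -> Prop).

Definition icongb (a b : iterm Y) : bool := `[< icong R a b >].

Lemma icongb_refl : reflexive icongb.
Proof. by move=> a; apply/asboolP/icong_refl. Qed.

Lemma icongb_sym : symmetric icongb.
Proof. by move=> a b; apply/asboolP/asboolP; apply: icong_sym. Qed.

Lemma icongb_trans : transitive icongb.
Proof.
by move=> b a c /asboolP ab /asboolP bc; apply/asboolP/(icong_trans ab bc).
Qed.

Canonical icong_equiv := EquivRel icongb icongb_refl icongb_sym icongb_trans.

Definition Inv := {eq_quot icong_equiv}.
HB.instance Definition _ := Choice.on Inv.

Definition iclass (t : iterm Y) : Inv := \pi_Inv t.

Lemma iclassP a b : iclass a = iclass b <-> icong R a b.
Proof.
split; last by move=> E; apply/eqmodP/asboolP.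
by move/eqmodP => /= /asboolP.
Qed.

Definition inv_mul (p q : Inv) : Inv := iclass (IMul (repr p) (repr q)).
Definition inv_one : Inv := iclass IOne.
Definition inv_inv (p : Inv) : Inv := iclass (IInv (repr p)).

Lemma irepr a : icong R (repr (iclass a)) a.
Proof. by apply/iclassP; rewrite /iclass reprK. Qed.

Lemma iclass_mul a b : iclass (IMul a b) = inv_mul (iclass a) (iclass b).
Proof. by apply/iclassP/icong_sym/icong_mul; apply: irepr. Qed.

Lemma iclass_inv a : iclass (IInv a) = inv_inv (iclass a).
Proof. by apply/iclassP/icong_sym/icong_inv; apply: irepr. Qed.

Lemma iclass_surj p : exists a, p = iclass a.
Proof. by exists (repr p); rewrite /iclass reprK. Qed.

Let iE := (=^~ iclass_mul, =^~ iclass_inv).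

Fact inv_mulA : associative inv_mul.
Proof.
move=> p q r.
have [[a ->] [b ->] [c ->]] := And3 (iclass_surj p) (iclass_surj q) (iclass_surj r).
by rewrite !iE; apply/iclassP/icong_mulA.
Qed.

Fact inv_mul1 : left_id inv_one inv_mul.
Proof.
move=> p; have [a ->] := iclass_surj p.
by rewrite /inv_one !iE; apply/iclassP/icong_mul1.
Qed.

Fact inv_1mul : right_id inv_one inv_mul.
Proof.
move=> p; have [a ->] := iclass_surj p.
by rewrite /inv_one !iE; apply/iclassP/icong_1mul.
Qed.

HB.instance Definition _ := isMonoid.Build Inv inv_mulA inv_mul1 inv_1mul.
HB.instance Definition _ := hasInv.Build Inv inv_inv.

Lemma iclassM a b : iclass (IMul a b) = iclass a * iclass b.
Proof. exact: iclass_mul. Qed.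
Lemma iclass1 : iclass IOne = 1. Proof. by []. Qed.
Lemma iclassV a : iclass (IInv a) = (iclass a)^-1.
Proof. exact: iclass_inv. Qed.

Fact inv_invK : involutive (@inv Inv).
Proof.
move=> p; have [a ->] := iclass_surj p.
by rewrite -(iclassV a) -(iclassV (IInv a)); apply/iclassP/icong_invK.
Qed.

Fact inv_invM : {morph @inv Inv : x y / x * y >-> y * x}.
Proof.
move=> p q; have [[a ->] [b ->]] := conj (iclass_surj p) (iclass_surj q).
by rewrite -(iclassM a b) -(iclassV a) -(iclassV b) -(iclassV (IMul a b))
           -(iclassM (IInv b)); apply/iclassP/icong_invM.
Qed.

HB.instance Definition _ := Monoid_isStarMonoid.Build Inv inv_invK inv_invM.

Fact inv_mulgVg (p : Inv) : p * p^-1 * p = p.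
Proof.
have [a ->] := iclass_surj p.
by rewrite -(iclassV a) -(iclassM a) -(iclassM (IMul _ _));
   apply/iclassP/icong_mulVg.
Qed.

Fact inv_mulgV_comm (p q : Inv) : p * p^-1 * (q * q^-1) = q * q^-1 * (p * p^-1).
Proof.
have [[a ->] [b ->]] := conj (iclass_surj p) (iclass_surj q).
by rewrite -(iclassV a) -(iclassV b) -(iclassM a) -(iclassM b)
           -!(iclassM (IMul _ _)); apply/iclassP/icong_comm.
Qed.

HB.instance Definition _ :=
  StarMonoid_isInverse.Build Inv inv_mulgVg inv_mulgV_comm.

End Presentation.

(* [inl x] is x, and [inr u] is ubar for the non-empty word u *)
Definition igenerator (X : Type) : Type := (X + {u : seq X | ~~ nilp u})%type.

Definition tgen X (x : X) : iterm (igenerator X) := IGen (inl x).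

(* ubar, with the convention that 1bar = 1 for the empty word *)
Definition tbar X (u : seq X) : iterm (igenerator X) :=
  match u with
  | [::] => IOne
  | x :: u' => IGen (inr (exist (fun w => ~~ nilp w) (x :: u') isT))
  end.

Definition tstar Y (a : iterm Y) : iterm Y := IMul (IInv a) a.

(* a relation a >= b stands for b = a b^* *)
Inductive calI_rel X : iterm (igenerator X) -> iterm (igenerator X) -> Prop :=
| calI_rel_gen x :
    calI_rel (tgen x) (IMul (tbar [:: x]) (tstar (tgen x)))
| calI_rel_mul u v : ~~ nilp u -> ~~ nilp v ->
    calI_rel (IMul (tbar u) (tbar v))
             (IMul (tbar (u ++ v)) (tstar (IMul (tbar u) (tbar v)))).

Definition calI (X : Type) := Inv (@calI_rel X).
HB.instance Definition _ X := InverseMonoid.on (calI X).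

Section SemidirectProduct.
Variable X : Type.
Implicit Types (u v : seq X) (e f : calI X).

Definition gen (x : X) : calI X := iclass (@calI_rel X) (tgen x).
Definition bar u : calI X := iclass (@calI_rel X) (tbar u).

Lemma bar_nil : bar [::] = 1. Proof. by []. Qed.

Lemma gen_le x : ile (gen x) (bar [:: x]).
Proof.
rewrite /ile /istar -(iclassV _ (tgen x)) -(iclassM _ (IInv _)).
by rewrite -(iclassM _ (tbar _)); apply/iclassP/icong_rel/calI_rel_gen.
Qed.

Lemma bar_cat u v : ile (bar u * bar v) (bar (u ++ v)).
Proof.
have [/nilP->|nu] := boolP (nilp u).
  rewrite /ile bar_nil mul1g /istar mulgA cat0s; exact/esym/mulgVg.
have [/nilP->|nv] := boolP (nilp v).
  rewrite /ile bar_nil mulg1 /istar mulgA cats0; exact/esym/mulgVg.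
rewrite /ile /istar -(iclassM _ (tbar u)) -(iclassV _ (IMul _ _)).
rewrite -(iclassM _ (IInv _)) -(iclassM _ (tbar _)).
by apply/iclassP/icong_rel/(calI_rel_mul nu nv).
Qed.

Definition sdprod_mem (p : calI X * seq X) : bool :=
  `[< idempotent p.1 /\ ile p.1 (iplus (bar p.2)) >].

(* E(I) >| X^*, the semidirect product; the membership condition says that e
   is an idempotent with e <= ubar^+ *)
Definition sdprod := {p : calI X * seq X | sdprod_mem p}.
HB.instance Definition _ := gen_eqMixin sdprod.
HB.instance Definition _ := gen_choiceMixin sdprod.

Definition sdmul_val (p q : calI X * seq X) :=
  (p.1 * iplus (bar p.2 * q.1), p.2 ++ q.2).
Definition sdone_val : calI X * seq X := (1, [::]).
Definition sdstar_val (p : calI X * seq X) : calI X * seq X :=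
  (istar (p.1 * bar p.2), [::]).
Definition sdplus_val (p : calI X * seq X) : calI X * seq X := (p.1, [::]).
Definition sdmax_val (p : calI X * seq X) := (iplus (bar p.2), p.2).
Definition sdgen_val (x : X) := (iplus (gen x), [:: x]).

Fact sdmul_mem (p q : sdprod) : sdprod_mem (sdmul_val (val p) (val q)).
Proof.
case: p q => [[e u] /= /asboolP[/= ee eu]] [[f v] /= /asboolP[/= ff fv]].
apply/asboolP => /=; split; first exact/idempotentM/idempotent_iplus.
have/ile_idempotent fv' : ile f (iplus (bar v)) by [].
apply/ile_idempotent; first exact/idempotentM/idempotent_iplus.
rewrite [RHS]mulgA (idempotent_comm (idempotent_iplus (bar (u ++ v))) ee) -mulgA.
congr (_ * _); rewrite [in RHS](_ : iplus (bar u * f) = bar u * f * (bar u * f)^-1) //.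
rewrite mulgA; congr (_ * _); rewrite (fv' ff) {2 3}/iplus.
have W := ile_iplusK (bar_cat u v).
by rewrite -(mulgA (bar v)) (mulgA (bar u)) [RHS]mulgA W.
Qed.

Fact sdone_mem : sdprod_mem sdone_val.
Proof.
apply/asboolP; split; first exact: idempotent1.
by rewrite /= bar_nil (idempotent_plusE (@idempotent1 _)); apply/ile1/idempotent1.
Qed.

Fact sd_nil_mem e : idempotent e -> sdprod_mem (e, [::]).
Proof.
move=> ee; apply/asboolP; split=> //=.
by rewrite bar_nil (idempotent_plusE (@idempotent1 _)); apply/ile1.
Qed.

Fact sdstar_mem (p : sdprod) : sdprod_mem (sdstar_val (val p)).
Proof. exact/sd_nil_mem/idempotent_istar. Qed.

Fact sdplus_mem (p : sdprod) : sdprod_mem (sdplus_val (val p)).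
Proof. by case: p => p /= /asboolP[ee _]; apply: sd_nil_mem. Qed.

Fact sdmax_mem (p : sdprod) : sdprod_mem (sdmax_val (val p)).
Proof.
apply/asboolP; split; first exact: idempotent_iplus.
apply/ile_idempotent; first exact: idempotent_iplus.
exact/esym/idempotent_iplus.
Qed.

Fact sdgen_mem x : sdprod_mem (sdgen_val x).
Proof.
apply/asboolP; split; first exact: idempotent_iplus.
exact/ile_iplus/gen_le.
Qed.

Definition sdmul (p q : sdprod) : sdprod := Sub _ (sdmul_mem p q).
Definition sdone : sdprod := Sub _ sdone_mem.
Definition sdstar (p : sdprod) : sdprod := Sub _ (sdstar_mem p).
Definition sdplus (p : sdprod) : sdprod := Sub _ (sdplus_mem p).
Definition sdmax (p : sdprod) : sdprod := Sub _ (sdmax_mem p).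

Definition sdgen (x : X) : sdprod := Sub _ (sdgen_mem x).

HB.instance Definition _ := hasMul.Build sdprod sdmul.
HB.instance Definition _ := hasOne.Build sdprod sdone.
HB.instance Definition _ := hasStarPlus.Build sdprod sdstar sdplus.
HB.instance Definition _ := hasSigmaMax.Build sdprod sdmax.

End SemidirectProduct.

(* Main.v *)
(* A birestriction monoid S acts on its semilattice of projections, s on the
   left by e |-> (s e)^+ and on the right by e |-> (e s)^*. These two maps are
   adjoint, and adjoint pairs of maps of a semilattice with 1 form an inverse
   monoid (inversion swaps the pair) whose idempotents are multiplications by
   projections. When S is F-birestriction and X maps to S, letting ubar act as
   (x_1 ... x_n)^m respects the relations of I, and evaluating idempotents of I
   at 1 gives a map theta from E(I) to P(S). Then (e, u) |-> theta(e) ubar is a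
   morphism extending X -> S. For S = FFBR(X) it inverts the morphism
   FFBR(X) -> E(I) >| X^* provided by the universal property, since a
   morphism S -> E(I) >| X^* carries the two actions back to
   k |-> (a k)^+ and k |-> (k a)^* on E(I). *)
From HB Require Import structures.
From mathcomp Require Import all_boot boolp.
Require Import Defs.

Set Implicit Arguments.
Unset Strict Implicit.
Unset Printing Implicit Defensive.

Local Open Scope group_scope.

(** * Idempotents in an inverse monoid *)

Section InverseMonoidTheory.
Variable M : inverseMonoidType.
Implicit Types a b e : M.

Lemma iplus_mul a : iplus a * a = a.
Proof. exact: mulgVg. Qed.

Lemma mul_istar a : a * istar a = a.
Proof. by rewrite /istar mulgA mulgVg. Qed.

Lemma istarE a : istar a = iplus a^-1.
Proof. by rewrite /iplus invgK. Qed.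

Lemma inv_idem_iplus a : (iplus a)^-1 = iplus a.
Proof. exact/inv_idempotent/idempotent_iplus. Qed.

Lemma iplus_mul_iplus a b : iplus (a * iplus b) = iplus (a * b).
Proof.
rewrite {1}/iplus invgM inv_idem_iplus mulgA -[X in X * _]mulgA.
by rewrite idempotent_iplus /iplus invgM !mulgA.
Qed.

Lemma istar_istar_mul a b : istar (istar a * b) = istar (a * b).
Proof.
by rewrite !istarE [in LHS]invgM inv_idem_iplus iplus_mul_iplus invgM.
Qed.

Lemma iplus_idemM e a : idempotent e -> iplus (e * a) = e * iplus a.
Proof.
move=> ee; rewrite {1}/iplus invgM (inv_idempotent ee) mulgA -(mulgA e a).
by rewrite -mulgA (idempotent_comm (idempotent_iplus a) ee) mulgA ee.
Qed.

Lemma istarM_idem a e : idempotent e -> istar (a * e) = istar a * e.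
Proof.
move=> ee; rewrite !istarE invgM (inv_idempotent ee) iplus_idemM //.
exact/idempotent_comm/idempotent_iplus.
Qed.

(** Idempotents of [M] commute, so [e] can pass [a * a^-1]. Together with [mul_idem_iplusE] this is
    the inverse monoid form of the ample identities [star_mul] and [mul_plus]. *)
Lemma mul_istar_idemM e a : idempotent e -> a * istar (e * a) = e * a.
Proof.
move=> ee; rewrite /istar invgM (inv_idempotent ee) !mulgA -(mulgA _ e e) ee.
by rewrite -[a * a^-1]/(iplus a) (idempotent_comm (idempotent_iplus a) ee)
           -mulgA iplus_mul.
Qed.

Lemma mul_idem_iplusE a e : idempotent e -> a * e = iplus (a * e) * a.
Proof.
move=> ee; rewrite {1}/iplus invgM (inv_idempotent ee) !mulgA -(mulgA a) ee.
by rewrite -!mulgA (idempotent_comm ee (idempotent_istar a)) !mulgA mulgVg.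
Qed.

Lemma ile_iplusE a b : ile b a -> b = iplus b * a.
Proof.
by move=> ba; rewrite {1}ba mul_idem_iplusE -?ba //; apply: idempotent_istar.
Qed.

(** Since e <= b^+, also (ae)^+ <= (ab)^+, and (ab)^+ c = ab. With [bar u], [bar v], [bar (u ++ v)]
    for [a], [b], [c] it controls products in the semidirect product. *)
Lemma iplus_mul_ile a b c e : ile (a * b) c -> idempotent e ->
  iplus b * e = e -> iplus (a * e) * c = a * e * b.
Proof.
move=> /ile_iplusE ab ee eb.
have ia x := @idempotent_iplus M x.
have le : iplus (a * b) * (a * e) = a * e.
  by rewrite -(iplus_mul_iplus a b) (mulgA _ a) -mul_idem_iplusE //
     -(mulgA a) eb.
have -> : iplus (a * e) = iplus (a * e) * iplus (a * b).
  by rewrite -{1}le iplus_idemM // (idempotent_comm (ia _) (ia (a * e))).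
by rewrite -(mulgA _ _ c) -ab (mulgA _ a) -mul_idem_iplusE.
Qed.

End InverseMonoidTheory.

(** * Projections, natural order and sigma in a birestriction monoid *)

Section BirestrictionTheory.
Variable S : birestrictionType.
Implicit Types s t e f : S.

Lemma star_projection s : projection (star s).
Proof. by exists s. Qed.

Lemma plus_projection s : projection (plus s).
Proof. by apply/projection_plus; exists s. Qed.

Lemma projection_plusE e : projection e -> plus e = e.
Proof. by case=> s ->; apply: plus_star. Qed.

Lemma star1 : star (1 : S) = 1.
Proof. by rewrite -[LHS]mul1g mul_star. Qed.

Lemma projection1 : projection (1 : S).
Proof. by exists 1; rewrite star1. Qed.

Lemma projection_comm e f : projection e -> projection f -> e * f = f * e.
Proof. by case=> s -> [t ->]; apply: star_comm. Qed.

Lemma plus_projectionM e s : projection e -> plus (e * s) = e * plus s.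
Proof. by move=> /projection_plusE E; rewrite -{1}E plus_plus_mul E. Qed.

Lemma star_mul_projection s e : projection e -> star (s * e) = star s * e.
Proof. by move=> /projection_star E; rewrite -{1}E star_mul_star E. Qed.

Lemma mul_projection s e : projection e -> s * e = plus (s * e) * s.
Proof. by move=> /projection_plusE E; rewrite -{1}E mul_plus. Qed.

Lemma projection_mul e s : projection e -> e * s = s * star (e * s).
Proof. by move=> /projection_star E; rewrite -{1}E star_mul. Qed.

Lemma plus_mul_plus s t : plus (s * plus t) = plus (s * t).
Proof.
by rewrite mul_plus plus_plus_mul plus_comm -plus_plus_mul mulgA plus_mul.
Qed.

Lemma star_star_mul s t : star (star s * t) = star (s * t).
Proof.
by rewrite star_mul star_mul_star star_comm -star_mul_star -mulgA mul_star.
Qed.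

Lemma projection_mulA e f s :
  projection e -> projection f -> e * (f * s) = f * (e * s).
Proof. by move=> Pe Pf; rewrite !mulgA (projection_comm Pe Pf). Qed.

(** Counterpart of [iplus_mul_ile] with projections for idempotents; it makes [sd_ext]
    multiplicative. *)
Lemma plus_mul_natle s t u e : natle (s * t) u -> projection e ->
  e * plus t = e -> plus (s * e) * u = s * e * t.
Proof.
move=> /natle_plusP st Pe et.
have -> : plus (s * e) = plus (s * e) * plus (s * t).
  rewrite -plus_plus_mul mulgA -(mul_projection s Pe) -(mulgA s e).
  by rewrite -(plus_mul_plus s (e * t)) (plus_projectionM t Pe) et.
by rewrite -mulgA -st mulgA -(mul_projection s Pe).
Qed.

Lemma natle_sigma s t : natle s t -> sigma s t.
Proof.
move/natle_starP => E; apply/sigmaP; exists (star s).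
  exact: star_projection.
by rewrite mul_star.
Qed.

Lemma sigma_sym s t : sigma s t -> sigma t s.
Proof. by move=> st r rC rP; exact/(cong_sym rC)/(st r). Qed.

Lemma sigma_trans s t u : sigma s t -> sigma t u -> sigma s u.
Proof.
by move=> st tu r rC rP; apply: (cong_trans rC (st r rC rP) (tu r rC rP)).
Qed.

Lemma sigma_mul s s' t t' : sigma s s' -> sigma t t' -> sigma (s * t) (s' * t').
Proof.
by move=> ss tt r rC rP; apply: (cong_mul rC); [apply: ss|apply: tt].
Qed.

Lemma natle_anti s t : natle s t -> natle t s -> s = t.
Proof.
move=> /natle_plusP E /natle_plusP F.
by rewrite {1}E {1}F mulgA plus_comm -mulgA plus_mul -F.
Qed.

End BirestrictionTheory.

(** * Inverse monoid terms acting on projections by adjoint pairs *)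

Section ProjectionAction.
Variables (S : birestrictionType) (Y : Type) (g : Y -> S).
Implicit Types (s t e f : S) (a b c : iterm Y) (d : bool).

Definition sact d s e := if d then plus (s * e) else star (e * s).

(* The left action for d = true, the right one for d = false. *)
Fixpoint pact d a e : S :=
  match a with
  | IGen y => sact d (g y) e
  | IOne => e
  | IMul a b => if d then pact d a (pact d b e) else pact d b (pact d a e)
  | IInv a => pact (~~ d) a e
  end.

Lemma sact_projection d s e : projection (sact d s e).
Proof. by case: d; [apply: plus_projection|apply: star_projection]. Qed.

Lemma pact_projection d a e : projection e -> projection (pact d a e).
Proof.
elim: a d e => [y||a IHa b IHb|a IHa] d e Pe //=; last exact: IHa.
  exact: sact_projection.
by case: d; [apply/IHa/IHb|apply/IHb/IHa].
Qed.

(** On the left, f s = s (fs)^* moves [f] inside the action; the right case is dual. This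
    Frobenius-type identity is the sense in which the two actions are adjoint. *)
Lemma sact_adjoint d s e f : projection e -> projection f ->
  sact d s e * f = sact d s (e * sact (~~ d) s f).
Proof.
move=> Pe Pf; case: d => /=.
  rewrite (projection_comm Pe (star_projection _)) mulgA -projection_mul //.
  rewrite -mulgA (plus_projectionM _ Pf).
  exact/projection_comm/Pf/plus_projection.
by rewrite -mulgA -mul_projection // mulgA (star_mul_projection _ Pf).
Qed.

Lemma pact_adjoint d a e f : projection e -> projection f ->
  pact d a e * f = pact d a (e * pact (~~ d) a f).
Proof.
elim: a d e f => [y||a IHa b IHb|a IHa] d e f Pe Pf //=.
- exact: sact_adjoint.
- by case: d; [rewrite IHa ?IHb//|rewrite IHb ?IHa//]; apply: pact_projection.
- exact: IHa.
Qed.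

Let P1 := @projection1 S.

(** The adjunction evaluated at 1. Elements a a^-1 thus act as multiplications by projections, hence
    commute. *)
Lemma pactVK d a e : projection e ->
  pact d a (pact (~~ d) a e) = pact d a 1 * e.
Proof. by move=> Pe; rewrite pact_adjoint // mul1g. Qed.

Lemma pact_mulVg d a e : projection e ->
  pact d a (pact (~~ d) a (pact d a e)) = pact d a e.
Proof.
move=> Pe; have Pa := pact_projection d a Pe.
have VK := pactVK (~~ d) a P1; rewrite negbK mulg1 in VK.
have P1a := pact_projection d a P1.
rewrite pactVK // (projection_comm P1a Pa) pact_adjoint // VK.
by rewrite -pact_adjoint // mulg1.
Qed.

Section Congruence.
Variable R : iterm Y -> iterm Y -> Prop.
Hypothesis pactR : forall a b, R a b ->
  forall d e, projection e -> pact d a e = pact d b e.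

(** Adjoint pairs satisfy the axioms of inverse monoids, so only the relations [R] have to be
    checked for the action to pass to the quotient. *)
Lemma pact_icong a b : icong R a b ->
  forall d e, projection e -> pact d a e = pact d b e.
Proof.
elim=> {a b} //=.
- by move=> a b _ IH d e Pe; rewrite IH.
- by move=> b a c _ IHa _ IHb d e Pe; rewrite IHa // IHb.
- move=> a a' b b' _ IHa _ IHb [] e Pe.
    by rewrite IHb // IHa //; apply: pact_projection.
  by rewrite IHa // IHb //; apply: pact_projection.
- by move=> a b _ IH d e Pe; rewrite IH.
- by move=> a b c [].
- by move=> a [].
- by move=> a [].
- by move=> a d e; rewrite negbK.
- by move=> a b [].
- by move=> a [] e Pe; [apply: (pact_mulVg true)|apply: (pact_mulVg false)].
- move=> a b d e Pe.
  have aa c h : projection h ->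
    pact true c (pact false c h) = pact true c 1 * h := @pactVK true c h.
  have PP c : projection (pact true c 1) by apply: pact_projection.
  have PM c : projection (pact true c 1 * e) by apply: projectionM.
  by case: d; rewrite /= (aa a e) // (aa b e) // (aa a _ (PM b))
    (aa b _ (PM a)) projection_mulA.
Qed.

End Congruence.

(** Restricted to projections because [IOne] acts as the identity, while [sact d 1] fixes
    projections only. *)
Definition acts_as a s := forall d e, projection e -> pact d a e = sact d s e.

Lemma acts_as_mul a b s t :
  acts_as a s -> acts_as b t -> acts_as (IMul a b) (s * t).
Proof.
move=> As Bt [] e Pe /=.
  by rewrite (Bt true) // (As true) /= ?plus_mul_plus ?mulgA //;
     apply: plus_projection.
by rewrite (As false) // (Bt false) /= ?star_star_mul ?mulgA //;
   apply: star_projection.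
Qed.

(** By [pactVK], [tstar a] acts as multiplication by [star s], so s = t s^* turns into the relation
    a = b a^* between actions. This is the form of every defining relation of I. *)
Lemma acts_as_le a b s t : acts_as a s -> acts_as b t -> natle s t ->
  forall d e, projection e -> pact d a e = pact d (IMul b (tstar a)) e.
Proof.
move=> As Bt /natle_starP st d e Pe.
have aa h : projection h -> pact false a (pact true a h) = star s * h.
  by move=> Ph; rewrite (pactVK false) // As //= mul1g.
rewrite As //; case: d => /=.
  by rewrite aa // Bt /= ?mulgA -?st //; apply: projectionM => //;
     apply: star_projection.
have Pb := pact_projection false b Pe.
rewrite aa // Bt //= star_comm -star_mul_star -mulgA -st //.
Qed.

End ProjectionAction.

(** * The semidirect product is an F-birestriction monoid *)

Section SemidirectProductTheory.
Variable X : Type.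
Implicit Types (p q r : sdprod X) (u v w : seq X) (e f : calI X).

Lemma sdprod_idem p : idempotent (val p).1.
Proof. by case: p => p /= /asboolP[]. Qed.

Lemma sdprod_le p : iplus (bar (val p).2) * (val p).1 = (val p).1.
Proof.
by case: p => p /= /asboolP[pp]; rewrite (ile_idempotent _ pp) => <-.
Qed.

Lemma sdprod_le_comm p : (val p).1 * iplus (bar (val p).2) = (val p).1.
Proof.
rewrite (idempotent_comm (sdprod_idem p)) ?sdprod_le //.
exact: idempotent_iplus.
Qed.

Lemma iplus_bar_mul u v e : idempotent e -> iplus (bar v) * e = e ->
  iplus (bar u * e) * bar (u ++ v) = bar u * e * bar v.
Proof. by move=> ee ev; apply: iplus_mul_ile (bar_cat u v) ee ev. Qed.

Lemma val_sdmul p q : val (p * q) = sdmul_val (val p) (val q).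
Proof. by []. Qed.
Lemma val_sdone : val (1 : sdprod X) = (1, [::]).
Proof. by []. Qed.
Lemma val_sdstar p : val (star p) = sdstar_val (val p).
Proof. by []. Qed.
Lemma val_sdplus p : val (plus p) = sdplus_val (val p).
Proof. by []. Qed.
Lemma val_sdmax p : val (sigmax p) = sdmax_val (val p).
Proof. by []. Qed.
Let valE := (val_sdmul, val_sdone, val_sdstar, val_sdplus, val_sdmax).

Fact sdprod_mulA : associative (@mul (sdprod X)).
Proof.
move=> p q r; apply: val_inj; rewrite !valE /sdmul_val /= catA; congr (_, _).
(* [E] trades the bar of a concatenation for a product of bars. *)
have E := iplus_bar_mul (val p).2 (sdprod_idem q) (sdprod_le q).
rewrite -(mulgA (val p).1); congr (_ * _).
rewrite -(iplus_idemM _ (idempotent_iplus _)) (mulgA _ (bar _)) E.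
by rewrite (mulgA (bar _)) iplus_mul_iplus !mulgA.
Qed.

Fact sdprod_mul1 : left_id 1 (@mul (sdprod X)).
Proof.
move=> p; apply: val_inj; rewrite !valE /sdmul_val /= bar_nil !mul1g.
by rewrite idempotent_plusE -?surjective_pairing //; apply: sdprod_idem.
Qed.

Fact sdprod_1mul : right_id 1 (@mul (sdprod X)).
Proof.
move=> p; apply: val_inj; rewrite !valE /sdmul_val /= mulg1 cats0.
by rewrite sdprod_le_comm -surjective_pairing.
Qed.

HB.instance Definition _ :=
  isMonoid.Build (sdprod X) sdprod_mulA sdprod_mul1 sdprod_1mul.

Fact sdprod_mul_star p : p * star p = p.
Proof.
apply: val_inj; rewrite !valE /sdmul_val /sdstar_val /= cats0 mul_istar_idemM.
  rewrite iplus_idemM ?sdprod_le_comm ?sdprod_idem -?surjective_pairing //.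
  exact: sdprod_idem.
exact: sdprod_idem.
Qed.

Lemma val_sdmul_nill p q : (val p).2 = [::] ->
  val (p * q) = ((val p).1 * (val q).1, (val q).2).
Proof.
move=> p0; rewrite valE /sdmul_val p0 bar_nil mul1g idempotent_plusE //.
exact: sdprod_idem.
Qed.

Lemma val_sdmul_nilr p q : (val q).2 = [::] ->
  val (p * q) = ((val p).1 * iplus (bar (val p).2 * (val q).1), (val p).2).
Proof. by move=> q0; rewrite valE /sdmul_val q0 cats0. Qed.

Fact sdprod_star_comm p q : star p * star q = star q * star p.
Proof.
apply: val_inj; rewrite !val_sdmul_nill //=; congr (_, _).
exact/idempotent_comm/idempotent_istar/idempotent_istar.
Qed.

Lemma sdprod_mul_barE p e : idempotent e ->
  (val p).1 * iplus (bar (val p).2 * e) * bar (val p).2 =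
  (val p).1 * bar (val p).2 * e.
Proof. by move=> ee; rewrite -mulgA -mul_idem_iplusE // mulgA. Qed.

Fact sdprod_star_mul_star p q : star (p * star q) = star p * star q.
Proof.
apply: val_inj; rewrite [RHS]val_sdmul_nill // valE /sdstar_val.
rewrite val_sdmul_nilr //=.
have ii := idempotent_istar ((val q).1 * bar (val q).2).
by rewrite (sdprod_mul_barE p ii) (istarM_idem _ ii).
Qed.

(** By [iplus_bar_mul], sending (e, u) to e ubar is multiplicative into I. As [star] is read off
    from this image, stars of products can be computed in I. *)
Lemma sdmul_bar p q : (val (p * q)).1 * bar (val (p * q)).2 =
  (val p).1 * bar (val p).2 * ((val q).1 * bar (val q).2).
Proof.
rewrite valE /= -mulgA iplus_bar_mul ?mulgA //; first exact: sdprod_idem.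
exact: sdprod_le.
Qed.

Fact sdprod_star_mul p q : star p * q = q * star (p * q).
Proof.
apply: val_inj; rewrite [LHS]val_sdmul_nill // [RHS]val_sdmul_nilr //.
congr (_, _) => /=.
have := sdmul_bar p q; rewrite valE /= => ->.
set a := _ * bar (val p).2.
(* The idempotent [istar a * (val q).1] passes through the bar of [q], and both sides reduce to
   it. *)
have ii := idempotentM (idempotent_istar a) (sdprod_idem q).
rewrite -(istar_istar_mul a) (mulgA (istar a)) (mul_istar_idemM _ ii).
rewrite (iplus_idemM _ ii) -(mulgA (istar a)) sdprod_le_comm.
by rewrite (idempotent_comm (sdprod_idem q) ii) -(mulgA (istar a)) sdprod_idem.
Qed.

Fact sdprod_plus_mul p : plus p * p = p.
Proof.
by apply: val_inj; rewrite val_sdmul_nill //= sdprod_idem -surjective_pairing.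
Qed.

Fact sdprod_plus_comm p q : plus p * plus q = plus q * plus p.
Proof.
apply: val_inj; rewrite !val_sdmul_nill //=; congr (_, _).
exact/idempotent_comm/sdprod_idem/sdprod_idem.
Qed.

Fact sdprod_plus_plus_mul p q : plus (plus p * q) = plus p * plus q.
Proof. by apply: val_inj; rewrite valE /sdplus_val !val_sdmul_nill. Qed.

Fact sdprod_mul_plus p q : p * plus q = plus (p * q) * p.
Proof.
apply: val_inj; rewrite [RHS]val_sdmul_nill // [LHS]val_sdmul_nilr //=.
congr (_, _).
set i := iplus _; have ii : idempotent i by apply: idempotent_iplus.
rewrite (idempotent_comm (idempotentM (sdprod_idem p) ii) (sdprod_idem p)).
by rewrite (mulgA _ (val p).1) sdprod_idem.
Qed.

Fact sdprod_star_plus p : star (plus p) = plus p.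
Proof.
apply: val_inj; rewrite valE /sdstar_val /= bar_nil mulg1 idempotent_starE //.
exact: sdprod_idem.
Qed.

Fact sdprod_plus_star p : plus (star p) = star p.
Proof. exact: val_inj. Qed.

HB.instance Definition _ := Monoid_isBirestriction.Build (sdprod X)
  sdprod_mul_star sdprod_star_comm sdprod_star_mul_star sdprod_star_mul
  sdprod_plus_mul sdprod_plus_comm sdprod_plus_plus_mul sdprod_mul_plus
  sdprod_star_plus sdprod_plus_star.

(** The membership condition e <= ubar^+ puts (ubar^+, u) above every pair with word [u]. *)
Lemma sdprod_le_max p q : (val p).2 = (val q).2 -> natle p (sigmax q).
Proof.
move=> pq; apply/natle_plusP/val_inj; rewrite val_sdmul_nill //= -pq.
by rewrite sdprod_le_comm -surjective_pairing.
Qed.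

Fact sdprod_max_sigma p : sigma p (sigmax p).
Proof. by apply: natle_sigma; apply: sdprod_le_max. Qed.

Fact sdprod_max_max p q : sigma p q -> natle q (sigmax p).
Proof.
(* Projections have the empty word, so [E] forces [p] and [q] to have the same word. *)
move=> /sigmaP[e [s es] E]; apply: sdprod_le_max; rewrite es in E.
by have := congr1 (snd \o val) E; rewrite /= !cats0.
Qed.

HB.instance Definition _ := Birestriction_isF.Build (sdprod X)
  sdprod_max_sigma sdprod_max_max.

End SemidirectProductTheory.

(** * Maximum elements of sigma-classes *)

Section SigmaMax.
Variable S : fbirestrictionType.
Implicit Types s t : S.

Lemma sigmax_eq s t : sigma s t -> sigmax s = sigmax t.
Proof.
move=> st; apply: natle_anti; apply: sigmax_max.
  exact: sigma_trans (sigma_sym st) (sigmax_sigma s).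
exact: sigma_trans st (sigmax_sigma t).
Qed.

Lemma natle_sigmax s : natle s (sigmax s).
Proof. by apply: sigmax_max => r rC _; apply: cong_refl. Qed.

Lemma sigmax1 : sigmax (1 : S) = 1.
Proof. by have /natle_starP := natle_sigmax 1; rewrite star1 mulg1. Qed.

Lemma sigmax_mul s t : natle (sigmax s * sigmax t) (sigmax (s * t)).
Proof. by apply: sigmax_max; apply: sigma_mul; apply: sigmax_sigma. Qed.

End SigmaMax.

(** * The morphism from the semidirect product to S extending f *)

Section Extension.
Variables (X : Type) (S : fbirestrictionType) (f : X -> S).
Implicit Types (u v : seq X) (d : bool) (h : S) (k l : calI X).

Definition wmax u : S := sigmax (\prod_(x <- u) f x).

Definition igen_val (y : igenerator X) : S :=
  match y with inl x => f x | inr u => wmax (sval u) end.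

Lemma wmax_nil : wmax [::] = 1.
Proof. by rewrite /wmax big_nil sigmax1. Qed.

Lemma wmax_gen x : natle (f x) (wmax [:: x]).
Proof. by rewrite /wmax big_seq1; apply: natle_sigmax. Qed.

Lemma wmax_cat u v : natle (wmax u * wmax v) (wmax (u ++ v)).
Proof. by rewrite /wmax big_cat; apply: sigmax_mul. Qed.

Lemma tbar_acts u : acts_as igen_val (tbar u) (wmax u).
Proof.
case: u => [|x u] d e Pe //=; rewrite wmax_nil.
by case: d; rewrite /= ?mul1g ?mulg1 ?projection_plusE ?projection_star.
Qed.

(** Both families of relations are inequalities, so [acts_as_le] reduces them to [wmax_gen] and
    [wmax_cat]. *)
Lemma pact_calI a b : icong (@calI_rel X) a b ->
  forall d h, projection h -> pact igen_val d a h = pact igen_val d b h.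
Proof.
apply: pact_icong => {a b} _ _ [x|u v _ _].
  by apply: acts_as_le (tbar_acts [:: x]) (wmax_gen x).
apply: acts_as_le (tbar_acts _) (wmax_cat u v).
exact/acts_as_mul/tbar_acts/tbar_acts.
Qed.

(** Uses the chosen representative of [k]; by [cactE] the choice does not matter on projections. *)
Definition cact d k h := pact igen_val d (repr k) h.

Lemma cactE d a h : projection h ->
  cact d (iclass (@calI_rel X) a) h = pact igen_val d a h.
Proof. exact/pact_calI/irepr. Qed.

Lemma cact_projection d k h : projection h -> projection (cact d k h).
Proof. exact: pact_projection. Qed.

Lemma cactM d k l h : projection h ->
  cact d (k * l) h = if d then cact d k (cact d l h) else cact d l (cact d k h).
Proof. by move=> Ph; rewrite [LHS]cactE. Qed.

Lemma cactV d k h : projection h -> cact d k^-1 h = cact (~~ d) k h.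
Proof. by move=> Ph; rewrite [LHS]cactE. Qed.

Lemma cact_bar d u h : projection h -> cact d (bar u) h = sact d (wmax u) h.
Proof. by move=> Ph; rewrite cactE // tbar_acts. Qed.

Lemma cact_gen d x h : projection h -> cact d (gen x) h = sact d (f x) h.
Proof. by move=> Ph; rewrite cactE. Qed.

Let P1 := @projection1 S.

(** The map theta, extended to all of I; by [cproj_iplus] its value at [k] is theta of [iplus k]. *)
Definition cproj k := cact true k 1.

Lemma cproj_projection k : projection (cproj k).
Proof. exact: cact_projection. Qed.

Lemma cact_iplus d k h : projection h -> cact d (iplus k) h = cproj k * h.
Proof.
move=> Ph; rewrite cactM //.
have VK : cact true k (cact false k h) = cproj k * h := pactVK _ true _ Ph.
by case: d; rewrite cactV //; apply: cact_projection.
Qed.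

Lemma cproj_iplus k : cproj (iplus k) = cproj k.
Proof. by rewrite /cproj cact_iplus // mulg1. Qed.

Lemma cact_idem d k h : idempotent k -> projection h ->
  cact d k h = cproj k * h.
Proof. by move=> kk Ph; rewrite -{1}(idempotent_plusE kk) cact_iplus. Qed.

Lemma cproj_idemM k l : idempotent k -> cproj (k * l) = cproj k * cproj l.
Proof.
by move=> kk; rewrite {1}/cproj cactM // cact_idem //; apply: cproj_projection.
Qed.

Lemma cproj_bar_mul u k : cproj (bar u * k) = plus (wmax u * cproj k).
Proof. by rewrite {1}/cproj cactM // cact_bar //; apply: cproj_projection. Qed.

(** Writing the star as the plus of the inverse turns the left action at 1 into the right action of
    [k], then of [bar u]. *)
Lemma cproj_istar_bar k u : idempotent k ->
  cproj (istar (k * bar u)) = star (cproj k * wmax u).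
Proof.
move=> kk; rewrite istarE cproj_iplus {1}/cproj (cactV _ _ P1) (cactM _ _ _ P1).
by rewrite /= (cact_idem _ kk P1) mulg1 cact_bar //; apply: cproj_projection.
Qed.

Definition sd_ext (p : sdprod X) : S := cproj (val p).1 * wmax (val p).2.

Lemma cproj_le (p : sdprod X) :
  cproj (val p).1 * plus (wmax (val p).2) = cproj (val p).1.
Proof.
rewrite -[in RHS]sdprod_le_comm cproj_idemM ?cproj_iplus;
  last exact: sdprod_idem.
by rewrite {3}/cproj cact_bar //= mulg1.
Qed.

Lemma sd_ext_hom : fbr_hom sd_ext.
Proof.
have PP := cproj_projection.
split.
- move=> p q; rewrite /sd_ext cproj_idemM ?cproj_iplus; last exact: sdprod_idem.
  rewrite cproj_bar_mul -!mulgA; congr (_ * _); rewrite mulgA.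
  (* The inequality e <= ubar^+ of [q], carried to S by theta, supplies the last premise. *)
  by apply: plus_mul_natle (wmax_cat _ _) _ _ => //; apply: cproj_le.
- by rewrite /sd_ext /= wmax_nil mulg1 /cproj cactE.
- move=> p; rewrite /sd_ext /= wmax_nil mulg1 cproj_istar_bar //.
  exact: sdprod_idem.
- by move=> p; rewrite /sd_ext /= wmax_nil mulg1 plus_projectionM // cproj_le.
- move=> p; rewrite {1}/sd_ext /= cproj_iplus /cproj cact_bar //=.
  rewrite mulg1 plus_mul.
  (* [wmax] is itself a [sigmax], and [sd_ext p] lies below it, hence in the same sigma-class. *)
  apply: sigmax_eq; apply: sigma_trans (sigmax_sigma _) _; apply: sigma_sym.
  apply: natle_sigma; exists (cproj (val p).1) => //.
Qed.

Lemma sd_ext_gen x : sd_ext (sdgen x) = f x.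
Proof.
rewrite /sd_ext /= cproj_iplus /cproj cact_gen //= mulg1.
exact/esym/natle_plusP/wmax_gen.
Qed.

(** * A morphism phi back to the semidirect product is a left inverse of the extension *)

Section Retraction.
Variable phi : S -> sdprod X.
Hypotheses (phiH : fbr_hom phi) (phif : forall x, phi (f x) = sdgen x).

Lemma phi_wmax u : val (phi (wmax u)) = (iplus (bar u), u).
Proof.
rewrite (fbr_hom_sigmax phiH) val_sdmax /sdmax_val.
(* [sigmax] in the semidirect product depends only on the word. *)
suff -> : (val (phi (\prod_(x <- u) f x))).2 = u by [].
elim: u => [|x u IH]; first by rewrite big_nil (fbr_hom_one phiH).
by rewrite big_cons (fbr_hom_mul phiH) phif val_sdmul /= IH.
Qed.

(** Induction on [a]: [phi] carries the actions on projections of S to those of I on its own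
    idempotents. Inverses swap the sides, as (a^-1 k)^+ = (k a)^* for idempotent [k]. *)
Lemma phi_pact d a h : projection h -> (val (phi h)).2 = [::] ->
  val (phi (pact igen_val d a h)) =
  (if d then iplus (iclass (@calI_rel X) a * (val (phi h)).1)
   else istar ((val (phi h)).1 * iclass (@calI_rel X) a), [::]).
Proof.
elim: a d h => [y||a IHa b IHb|a IHa] d h Ph h0.
(* Treats both kinds of generators at once: [k] is the class of [y], and [u] is [[:: x]] for a
   letter x or the word itself for a barred word. *)
- have [u [k [yu ye ky]]] : exists u k,
      [/\ val (phi (igen_val y)) = (iplus k, u),
      k = iclass (@calI_rel X) (IGen y) & ile k (bar u)].
    case: y => [x|[[|x u] nu]] //.
      by exists [:: x], (gen x); split=> //=; [rewrite phif|apply: gen_le].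
    exists (x :: u), (bar (x :: u)); split; first by rewrite phi_wmax.
      by congr (iclass _ (IGen (inr (exist _ _ _)))); apply: bool_irrelevance.
    by rewrite /ile mul_istar.
  (* Since k = k^+ ubar, the pair (k^+, u) acts on idempotents as [k] does. *)
  have kE := ile_iplusE ky; rewrite -ye; case: d => /=.
    rewrite (fbr_hom_plus phiH) (fbr_hom_mul phiH) val_sdplus val_sdmul.
    rewrite /sdplus_val /sdmul_val yu /=; congr (_, _).
    by rewrite {2}kE -(mulgA (iplus k)) (iplus_idemM _ (idempotent_iplus k)).
  rewrite (fbr_hom_star phiH) (fbr_hom_mul phiH) val_sdstar val_sdmul.
  rewrite /sdstar_val /sdmul_val yu h0 bar_nil mul1g /=; congr (istar _, _).
  rewrite (idempotent_plusE (idempotent_iplus k)) {2}kE.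
  by rewrite (mulgA _ (iplus k)).
- rewrite (_ : iclass _ _ = 1) // mulg1 mul1g; have hh := sdprod_idem (phi h).
  rewrite (idempotent_plusE hh) (idempotent_starE hh) if_same /=.
  by rewrite [LHS]surjective_pairing h0.
- rewrite iclassM; case: d => /=.
    rewrite IHa ?IHb //=; [|exact: pact_projection].
    by rewrite iplus_mul_iplus mulgA.
  rewrite IHb ?IHa //=; [|exact: pact_projection].
  by rewrite istar_istar_mul mulgA.
- rewrite /= IHa // iclassV; have hh := sdprod_idem (phi h).
  by case: d => /=; rewrite istarE invgM (inv_idempotent hh) ?invgK.
Qed.

Lemma sd_extK : cancel sd_ext phi.
Proof.
move=> p; apply: val_inj; rewrite (fbr_hom_mul phiH).
have phi1 := fbr_hom_one phiH.
(* [cproj] evaluates a representative term at 1, so [phi_pact] gives (e 1)^+, which is e for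
   idempotent e. *)
have phic : val (phi (cproj (val p).1)) = ((val p).1, [::]).
  rewrite phi_pact ?phi1 //= /iclass reprK mulg1 idempotent_plusE //.
  exact: sdprod_idem.
rewrite val_sdmul_nill ?phic // phi_wmax /=.
by rewrite sdprod_le_comm -surjective_pairing.
Qed.

End Retraction.
End Extension.

(** * The canonical isomorphism *)

Theorem theorem7p9 (X : Type) (X_nonempty : inhabited X) :
  exists phi : FFBR X -> sdprod X,
    [/\ fbr_hom phi, bijective phi
      & forall x : X, phi (ffbr_gen x) = sdgen x].
Proof.
have [phi [phiH phig _]] := ffbr_universal (@sdgen X).
exists phi; split=> //; exists (sd_ext (@ffbr_gen X)); last exact: sd_extK.
(* Both [sd_ext (@ffbr_gen X) \o phi] and [id] are endomorphisms of [FFBR X] fixing the generators,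
   so both equal the unique such [g]. *)
have [g [_ _ gU]] := ffbr_universal (@ffbr_gen X).
have [psiM psi1 psiS psiP psiX] := sd_ext_hom (@ffbr_gen X).
have [phiM phi1 phiS phiP phiX] := phiH.
move=> s; transitivity (g s).
  apply: (gU (sd_ext (@ffbr_gen X) \o phi)) => [|x]; last first.
    by rewrite /= phig sd_ext_gen.
  split=> [a b||a|a|a] /=.
  - by rewrite phiM psiM.
  - by rewrite phi1 psi1.
  - by rewrite phiS psiS.
  - by rewrite phiP psiP.
  - by rewrite phiX psiX.
by rewrite -(gU id).
Qed.
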